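(* For every integer $n \ge 0$, the $n$th Catalan number $C_n$ is equal to the sum of the squares of the elements in the $n$th column of the Dyck triangle, that is, $$C_n = \sum_{k=0}^{\lfloor n/2 \rfloor} d(n, n-2k)^2 .$$
   Context: The $n$th Catalan number is $C_n = \frac{1}{n+1}\binom{2n}{n}$, $n \ge 0$; it is the number of Dyck words of semilength $n$ (balanced strings of $n$ left and $n$ right parentheses), equivalently the number of lattice paths from $(0,0)$ to $(2n,0)$ with steps $(1,1)$ (upsteps) and $(1,-1)$ (downsteps) that never go below the horizontal axis. For integers $i, j \ge 0$, let $d(i,j)$ denote the number of lattice paths from $(0,0)$ to $(i,j)$ with steps $(1,1)$ and $(1,-1)$ all of whose vertices have non-negative ordinate (the path consisting of no steps gives $d(0,0)=1$). The value $d(i,j)$ is nonzero exactly when $0 \le j \le i$ and $i+j$ is even. The Dyck triangle is the array of the nonzero values $d(i,j)$ placed at the points $(i,j)$ of the plane. Its $n$th column consists of the nonzero values with abscissa $i=n$, i.e. the $\lfloor n/2\rfloor+1$ numbers $d(n,n), d(n,n-2), \ldots, d(n, n-2\lfloor n/2\rfloor)$. *)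

(* Defs.v *)
From mathcomp Require Import all_boot all_order all_algebra.

Set Implicit Arguments.
Unset Strict Implicit.
Unset Printing Implicit Defensive.

Import GRing.Theory Num.Theory.
Local Open Scope ring_scope.

(* Taken in rat, so that the division is exact by construction. *)
Definition catalan (n : nat) : rat := n.+1%:R^-1 * 'C((2 * n)%N, n)%:R.

(* A path starting at (0,0) is encoded by its sequence of steps: true is the
   upstep (1,1) and false the downstep (1,-1).  Since every step increases the
   abscissa by 1, the k-th vertex has abscissa k. *)
Definition step_ordinate (y : int) (up : bool) : int :=
  if up then y + 1 else y - 1.

(* Ordinates of all the vertices, including the initial vertex (0,0). *)
Definition ordinates (s : seq bool) : seq int := 0 :: scanl step_ordinate 0 s.

(* Paths ending at abscissa i are exactly those with i steps. *)
Definition d (i j : nat) : nat :=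
  #|[set s : i.-tuple bool |
       all (fun y : int => 0 <= y) (ordinates s)
       && (last 0 (ordinates s) == j%:Z)]|.

(* Main.v *)
Require Import Defs.
From mathcomp Require Import all_boot all_order all_algebra.
From mathcomp Require Import zify ring.

Set Implicit Arguments.
Unset Strict Implicit.
Unset Printing Implicit Defensive.

Import GRing.Theory Num.Theory.
Local Open Scope ring_scope.

(** Removing the last step of a path shows that the column [d i.+1] is obtained
    from [d i] by the neighbour-sum operator [nbr_sum] of the half-line
    0 - 1 - 2 - ... ([dS]).  This operator is symmetric for the scalar product
    of columns ([nbr_sum_sym]), so it can be moved from one factor to the other:
    [<d m.+1, d n> = <d m, d n.+1>].  Iterating, [<d m, d n>] depends only on
    [m + n] and equals [<d 0, d (m + n)> = d (m + n) 0] ([sum_d_mul]).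
    Combinatorially, a path of length [m + n] back to the axis is cut at
    abscissa [m], and its second part is read backwards.

    Taking [m = n], the sum of the squares of column [n] is the number
    [d (2n) 0] of Dyck words, which the ballot formula ([ballot]) identifies
    with the Catalan number; entries of the wrong parity vanish ([d_odd]), so
    the sum over the whole column is the sum over its nonzero entries. *)

Definition dyck_path (j : nat) (s : seq bool) : bool :=
  all (fun y : int => 0 <= y) (ordinates s) && (last 0 (ordinates s) == j%:Z).

Lemma dyck_path_rcons (j : nat) (s : seq bool) (up : bool) :
  dyck_path j (rcons s up) =
    if up then (if j is j'.+1 then dyck_path j' s else false)
    else dyck_path j.+1 s.
Proof.
rewrite /dyck_path /ordinates -!cats1 scanl_cat /= last_cat all_cat /= andbT.
have -> : foldl step_ordinate 0 s = last 0 (scanl step_ordinate 0 s).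
  by elim: s 0 => //= b s IH z; exact: IH.
set y := last 0 (scanl _ _ _).
have pos : all (fun y : int => 0 <= y) (scanl step_ordinate 0 s) -> 0 <= y.
  move=> /allP sP; rewrite /y; case: (scanl _ _ _) sP => //= a l; apply.
  exact: mem_last.
move: pos; case: (all _ _) => //= pos; last by case: up; case: j.
have {pos} := pos isT.
by case: up j => [] [|j] /=; lia.
Qed.

Lemma dE (i j : nat) : d i j = (\sum_(s : i.-tuple bool) dyck_path j s)%N.
Proof.
rewrite /d -sum1_card (eq_bigl (fun s : i.-tuple bool => dyck_path j s)).
  by rewrite big_mkcond /=; apply: eq_bigr => s _; case: (dyck_path _ _).
by move=> s; rewrite inE.
Qed.

(** The value 0 to the left of ordinate 0 expresses that no path comes from
    below the axis. *)
Definition nbr_sum (f : nat -> nat) (j : nat) : nat :=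
  ((if j is j'.+1 then f j' else 0) + f j.+1)%N.

Lemma big_tuple_rcons (T : finType) (n : nat) (F : seq T -> nat) :
  (\sum_(s : n.+1.-tuple T) F s =
   \sum_(x : T) \sum_(s : n.-tuple T) F (rcons s x))%N.
Proof.
rewrite pair_bigA /=.
pose h (p : T * n.-tuple T) := [tuple of rcons p.2 p.1].
rewrite (reindex h) //=.
pose g (t : n.+1.-tuple T) : T * n.-tuple T :=
  (thead [tuple of rev t], [tuple of rev (behead (rev t))]).
exists g => [[x s] _|t _].
  rewrite /g /h; congr pair; last by apply: val_inj; rewrite /= rev_rcons /= revK.
  by rewrite /thead (tnth_nth x) /= rev_rcons.
apply: val_inj => /=; rewrite -rev_cons.
have /(congr1 val) /= <- := tuple_eta [tuple of rev t].
exact: revK.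
Qed.

Lemma dS (i : nat) : d i.+1 =1 nbr_sum (d i).
Proof.
move=> j; rewrite dE (big_tuple_rcons _ (fun s => dyck_path j s)) big_bool /=.
rewrite /nbr_sum [in RHS]dE; congr addn.
  case: j => [|j]; first by rewrite big1 // => s _; rewrite dyck_path_rcons.
  by rewrite dE; apply: eq_bigr => s _; rewrite dyck_path_rcons.
by apply: eq_bigr => s _; rewrite dyck_path_rcons.
Qed.

Lemma d0 (j : nat) : d 0 j = (j == 0%N).
Proof.
rewrite dE (bigD1 [tuple]) //= big1 ?addn0; first by case: j.
by move=> s; rewrite tuple0.
Qed.

Lemma d_gt (i j : nat) : (i < j)%N -> d i j = 0%N.
Proof.
elim: i j => [|i IH] [|j] // ij; first by rewrite d0.
by rewrite dS /nbr_sum !IH //; lia.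
Qed.

Lemma d_odd (i j : nat) : odd (i + j) -> d i j = 0%N.
Proof.
elim: i j => [|i IH] j; first by rewrite d0; case: j.
move=> ij; rewrite dS /nbr_sum (IH j.+1); last by lia.
by case: j ij => // j ij; rewrite IH //; lia.
Qed.

(** Green's identity for the half-line: the truncated scalar products differ
    only by a boundary term, which disappears for finitely supported [f], [g]. *)
Lemma nbr_sum_green (f g : nat -> nat) (M : nat) :
  (\sum_(0 <= j < M.+1) nbr_sum f j * g j + f M * g M.+1 =
   \sum_(0 <= j < M.+1) f j * nbr_sum g j + f M.+1 * g M)%N.
Proof.
elim: M => [|M IH]; first by rewrite !big_nat1 /nbr_sum; ring.
rewrite big_nat_recr //= [in RHS]big_nat_recr //=.
rewrite [nbr_sum f M.+1]/nbr_sum [nbr_sum g M.+1]/nbr_sum mulnDl mulnDr; lia.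
Qed.

Lemma nbr_sum_sym (f g : nat -> nat) (M : nat) :
  f M.+1 = 0%N -> g M.+1 = 0%N ->
  (\sum_(0 <= j < M.+1) nbr_sum f j * g j =
   \sum_(0 <= j < M.+1) f j * nbr_sum g j)%N.
Proof.
by move=> f0 g0; have := nbr_sum_green f g M; rewrite f0 g0 muln0 mul0n !addn0.
Qed.

(** The range of summation contains both supports and depends only on [m + n],
    so it does not change while steps are moved from one column to the other. *)
Lemma sum_d_mul (m n : nat) :
  (\sum_(0 <= j < (m + n).+1) d m j * d n j = d (m + n) 0)%N.
Proof.
elim: m n => [|m IH] n.
  rewrite big_nat_recl // d0 mul1n big1 ?addn0 // => j _.
  by rewrite d0.
rewrite addSnnS -IH.
under eq_bigr do rewrite dS.
under [RHS]eq_bigr do rewrite dS.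
by apply: nbr_sum_sym; apply: d_gt; lia.
Qed.

(** The reflection principle gives [d (j + 2k) j = 'C(i, k) - 'C(i, k - 1)]
    with [i = j + 2k].  Adding ['C(i.+1, k) = 'C(i, k) + 'C(i, k - 1)] makes the
    formula subtraction-free and uniform in [k], including [k = 0]. *)
Lemma ballot (j k : nat) :
  (d (j + k.*2) j + 'C((j + k.*2).+1, k) = 2 * 'C(j + k.*2, k))%N.
Proof.
move: {2}(j + k.*2)%N (erefl (j + k.*2)%N) => i.
elim: i j k => [|i IH] j k Di.
  have [-> ->] : j = 0%N /\ k = 0%N by lia.
  by rewrite d0 !bin0.
rewrite Di dS /nbr_sum; case: k Di => [|k] Di.
  case: j Di => [|j] Di; first by lia.
  have Ej : j = i by lia.
  have := IH j 0%N; rewrite addn0 !bin0 Ej (d_gt (leqnSn i.+1)) => /(_ erefl).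
  lia.
have IH1 := IH j.+1 k; case: j Di IH1 => [|j] Di IH1.
  (* On the axis one neighbour is missing; the symmetry of row [i = 2k + 1]
     of Pascal's triangle compensates for it. *)
  have Ei : (1 + k.*2)%N = i by lia.
  have mid : ('C(i, k.+1) = 'C(i, k))%N.
    by rewrite -bin_sub; last lia; congr binomial; lia.
  by move: IH1; rewrite Ei => /(_ erefl); rewrite !binS; lia.
have E1 : (j.+2 + k.*2)%N = i by lia.
have E2 : (j + k.+1.*2)%N = i by lia.
by move: IH1 (IH j k.+1 E2); rewrite E1 E2 => /(_ erefl); rewrite !binS; lia.
Qed.

Lemma catalan_d (n : nat) : catalan n = (d n.*2 0)%:R.
Proof.
rewrite /catalan mul2n; apply: (canLR (mulKf _)); first by rewrite pnatr_eq0.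
rewrite -natrM; congr (_%:R).
have := ballot 0 n; rewrite add0n => B.
have /= := mul_bin_down n.*2.+1 n.
rewrite (_ : (n.*2.+1 - n)%N = n.+1); [nia | lia].
Qed.

Lemma big_nat_parity (F : nat -> nat) (n : nat) :
  (forall j, odd (n + j) -> F j = 0%N) ->
  (\sum_(0 <= j < n.+1) F j = \sum_(0 <= k < n./2.+1) F (n - k.*2))%N.
Proof.
elim/ltn_ind: n => -[|[|n]] IH F0; first by rewrite !big_nat1.
  by rewrite big_nat_recl // !big_nat1 F0.
rewrite big_nat_recr //= [in LHS]big_nat_recr //= IH //; last first.
  by move=> j nj; apply: F0; rewrite !addSn /= negbK.
rewrite [F n.+1]F0 ?addn0; last by lia.
by rewrite [RHS]big_nat_recl // addnC subn0.
Qed.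

Theorem theorem1 (n : nat) :
  catalan n = (\sum_(0 <= k < n./2.+1) d n (n - k.*2) ^ 2)%N%:R.
Proof.
rewrite catalan_d; congr (_%:R).
rewrite -(big_nat_parity (F := fun j => d n j ^ 2)%N); last first.
  by move=> j nj; rewrite d_odd.
rewrite -addnn -sum_d_mul (@big_cat_nat _ _ _ n.+1) //=; last by lia.
rewrite [X in (_ + X)%N]big_nat_cond [X in (_ + X)%N]big1 ?addn0 //.
by move=> j /andP[/andP[nj _] _]; rewrite d_gt.
Qed.
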